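(* For a positive integer $k$, let $m_k$ denote the minimum order of a connected graph $G$ with $c(G)\geq k$. Then: (1) $m_k = O(k^2)$ as $k\to\infty$. (2) The following two statements are equivalent: (i) (Meyniel's conjecture) there is a constant $d>0$ such that every connected graph $G$ of order $n$ satisfies $c(G)\leq d\sqrt{n}$; (ii) $m_k=\Omega(k^2)$ as $k\to\infty$.
   Context: Cops and Robbers is played on a finite, connected, undirected graph $G$. Cops first each choose a starting vertex, then the robber does; thereafter players alternate rounds, cops first, each player moving to an adjacent vertex or staying put (several cops may share a vertex). The cops win if some cop eventually occupies the robber's vertex. The cop number $c(G)$ is the minimum number of cops that have a winning strategy. *)

(* Defs.v *)
From HB Require Import structures.
From mathcomp Require Import all_boot all_order all_algebra.
From mathcomp Require Import boolp classical_sets reals topology normedtype landau.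

Set Implicit Arguments.
Unset Strict Implicit.
Unset Printing Implicit Defensive.

Import Order.TTheory GRing.Theory Num.Theory.
Import numFieldNormedType.Exports.

Record graph := Graph {
  vertex :> finType;
  adj : rel vertex;
  adj_sym : symmetric adj;
  adj_irr : irreflexive adj
}.

Definition graph_order (G : graph) : nat := #|vertex G|.

Definition connected_graph (G : graph) : Prop :=
  0 < graph_order G /\ forall x y : G, connect (@adj G) x y.

Definition legal_move (G : graph) (x y : G) : Prop := x = y \/ adj x y.

(* A strategy of [k] cops maps the list of the robber's positions so far, in
   chronological order, to the current positions of the cops: [s [::]] is the
   initial placement, chosen before the robber's, and [s [:: r_0; ...; r_t]] is
   the position of the cops after their answer to the robber being at [r_t]. *)
Definition cop_strategy (G : graph) (k : nat) := seq G -> 'I_k -> G.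

Definition legal_strategy (G : graph) (k : nat) (s : cop_strategy G k) : Prop :=
  forall (h : seq G) (x : G) (i : 'I_k), legal_move (s h i) (s (rcons h x) i).

Definition robber_play (G : graph) (r : nat -> G) : Prop :=
  forall t, legal_move (r t) (r t.+1).

(* The two cases are a meeting right after the robber's arrival at [r t], and
   right after the answer of the cops. *)
Definition captures (G : graph) (k : nat) (s : cop_strategy G k)
    (r : nat -> G) : Prop :=
  exists (t : nat) (i : 'I_k),
    s (mkseq r t) i = r t \/ s (mkseq r t.+1) i = r t.

Definition cops_win (G : graph) (k : nat) : Prop :=
  exists s : cop_strategy G k,
    legal_strategy s /\ forall r, robber_play r -> captures s r.

Lemma cops_win_order (G : graph) : cops_win G (graph_order G).
Proof.
exists (fun _ => @enum_val G (mem predT)); split=> [h x i|r _]; first by left.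
by exists 0, (enum_rank (r 0)); left; rewrite enum_rankK.
Qed.

Lemma ex_cops_win (G : graph) : exists k, `[< cops_win G k >].
Proof. by exists (graph_order G); apply/asboolP; apply: cops_win_order. Qed.

Definition cop_number (G : graph) : nat := ex_minn (ex_cops_win G).

Definition is_min_order (k n : nat) : Prop :=
  (exists G : graph, [/\ connected_graph G, k <= cop_number G & graph_order G = n]) /\
  (forall G : graph, connected_graph G -> k <= cop_number G -> n <= graph_order G).

(* Meaningful only together with [is_min_order k (min_order k)]: the default
   value is [0] if no connected graph has cop number at least [k]. *)
Definition min_order (k : nat) : nat := xget 0 [set n | is_min_order k n]%classic.

Local Open Scope ring_scope.

Definition meyniel_conjecture (R : realType) : Prop :=
  exists2 d : R, 0 < d &
    forall G : graph, connected_graph G ->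
      (cop_number G)%:R <= d * Num.sqrt (graph_order G)%:R.

(* Main.v *)
Require Import Defs.
From mathcomp Require Import all_boot all_order all_algebra.
From mathcomp Require Import finfield ring.
From mathcomp Require Import boolp classical_sets reals topology normedtype landau.

(** In a graph without cycles of length 3 or 4, the closed neighbourhood of a
    vertex [c <> u] contains at most one neighbour of [u].  Fewer cops than the
    minimum degree therefore always leave the robber a neighbour that no cop can
    reach in one move, so the cop number is at least the minimum degree.  The
    incidence graph of the points and the non-vertical lines of the affine plane
    over the field with [q] elements is connected, [q]-regular, without such
    cycles, and has [2 q^2] vertices; taking for [q] the power of two with
    [q / 2 <= k < q] gives [m_k <= 8 k^2].  The equivalence only unfolds the
    definition of [m_k]: Meyniel's bound [k <= d sqrt n] reads [k^2 <= d^2 n],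
    and the finitely many small cop numbers are absorbed in the constant. *)

Import Order.TTheory GRing.Theory Num.Theory.
Import numFieldNormedType.Exports.
Local Open Scope classical_set_scope.
Local Open Scope ring_scope.

(** * Evasion of few cops in graphs without short cycles *)

Definition triangle_free (G : graph) : Prop :=
  forall x y z : G, adj x y -> adj y z -> adj x z -> False.

Definition square_free (G : graph) : Prop :=
  forall x y u v : G, x != y ->
    adj x u -> adj x v -> adj y u -> adj y v -> u = v.

Definition min_degree_ge (G : graph) (d : nat) : Prop :=
  forall u : G, (d <= #|[pred v | adj u v]|)%N.

Lemma legal_moveP (G : graph) (x y : G) :
  reflect (legal_move x y) ((x == y) || adj x y).
Proof. by apply: (iffP orP) => -[/eqP|] ?; [left|right|left|right]. Qed.

(** If [c] is one of [v], [w] and adjacent to the other, then [u], [v], [w] form a triangle; if [c]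
    is adjacent to both, [c] and [u] are opposite corners of a 4-cycle. *)
Lemma common_neighbour_uniq (G : graph) (u c v w : G) :
  triangle_free G -> square_free G -> c != u ->
  adj u v -> adj u w -> legal_move c v -> legal_move c w -> v = w.
Proof.
move=> tri sq cu uv uw [cv|cv] [cw|cw].
- by rewrite -cv.
- by case: (tri u v w) => //; rewrite -cv.
- by case: (tri u w v) => //; rewrite -cw.
- exact: (sq c u).
Qed.

Lemma exists_safe_neighbour (G : graph) (d k : nat) (c : 'I_k -> G) (u : G) :
  triangle_free G -> square_free G -> min_degree_ge G d -> (k < d)%N ->
  (forall i, c i != u) ->
  exists2 v, adj u v & forall i, ~ legal_move (c i) v.
Proof.
move=> tri sq deg kd cu; apply: contrapT => noex.
have attacked v : adj u v -> exists i, legal_move (c i) v.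
  move=> uv; apply: contrapT => noi; apply: noex; exists v => // i ci.
  by apply: noi; exists i.
have [f fP] : exists f : G -> 'I_k, forall v, adj u v -> legal_move (c (f v)) v.
  have [w uw] : exists w, adj u w.
    by have /card_gt0P[w] := leq_trans (leq_ltn_trans (leq0n k) kd) (deg u); exists w.
  have [i0 _] := attacked w uw.
  exists (fun v => odflt i0 [pick i | (c i == v) || adj (c i) v]) => v uv.
  case: pickP => [i /legal_moveP //|none].
  by have [i /legal_moveP] := attacked v uv; rewrite none.
(* One cop attacks at most one neighbour of [u], so [d] neighbours would need [d] cops. *)
have finj : {in [pred v | adj u v] &, injective f}.
  move=> v w; rewrite !inE => uv uw fvw.
  apply: (common_neighbour_uniq _ _ _ _ _ tri sq (cu (f v)) uv uw); first exact: fP.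
  by rewrite fvw; apply: fP.
have := max_card (mem [set f v | v in [pred v | adj u v]]%SET).
by rewrite card_in_imset // card_ord leqNgt (leq_trans kd (deg u)).
Qed.

Lemma robber_evades (G : graph) (d k : nat) :
  triangle_free G -> square_free G -> min_degree_ge G d -> (0 < graph_order G)%N ->
  (k < d)%N -> ~ cops_win G k.
Proof.
move=> tri sq deg G0 kd [s [sleg swin]].
(* A fictitious position before the game: the robber actually starts at a safe neighbour of [u0], so
   the first choice follows the same rule as all later ones. *)
have [u0 u0P] : exists u0, forall i, s [::] i != u0.
  have kG : (#|[set s [::] i | i in 'I_k]%SET| < #|G|)%N.
    apply: leq_ltn_trans (leq_imset_card _ _) _; rewrite card_ord.
    have /card_gt0P[w _] := G0.
    exact: leq_trans kd (leq_trans (deg w) (max_card _)).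
  have /card_gt0P[u] : (0 < #|~: [set s [::] i | i in 'I_k]%SET|)%N.
    by rewrite cardsCs finset.setCK subn_gt0.
  rewrite inE => /imsetP us; exists u => i.
  by apply/eqP => siu; apply: us; exists i.
pose safe h v := adj (last u0 h) v && [forall i, ~~ ((s h i == v) || adj (s h i) v)].
pose step h := odflt u0 [pick v | safe h v].
have stepP h : (forall i, s h i != last u0 h) -> safe h (step h).
  move=> free; rewrite /step; case: pickP => // none.
  have [v uv vP] := @exists_safe_neighbour G d k (s h) _ tri sq deg kd free.
  have /negP[] := negbT (none v); rewrite /safe uv /=.
  by apply/forallP => i; apply/legal_moveP.
(* The cops' strategy is fixed, so the whole robber's play can be computed against it in advance.
   The invariant is that no cop stands on the robber's vertex after the cops' answer. *)
pose fix hist n := if n is m.+1 then rcons (hist m) (step (hist m)) else [::].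
have histP t : forall i, s (hist t) i != last u0 (hist t).
  elim: t => [//|t IH] i; have /andP[_ /forallP/(_ i)] := stepP _ IH.
  rewrite /= last_rcons => /legal_moveP nl; apply/eqP => eq_s; apply: nl.
  by have := sleg (hist t) (step (hist t)) i; rewrite eq_s.
pose r t := step (hist t).
have histE t : hist t = mkseq r t by elim: t => // t IH; rewrite mkseqS -IH.
have rplay : robber_play r.
  move=> t; right; have /andP[+ _] := stepP _ (histP t.+1).
  by rewrite [hist t.+1]/= last_rcons.
have [t [i]] := swin r rplay.
rewrite -!histE => -[caught|caught].
  have /andP[_ /forallP/(_ i)] := stepP _ (histP t).
  by rewrite caught eqxx.
by have := histP t.+1 i; rewrite caught /= last_rcons eqxx.
Qed.

Lemma cop_number_ge_min_degree (G : graph) (d : nat) :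
  triangle_free G -> square_free G -> min_degree_ge G d -> (0 < graph_order G)%N ->
  (d <= cop_number G)%N.
Proof.
move=> tri sq deg G0; rewrite /cop_number; case: ex_minnP => k /asboolP win _.
by rewrite leqNgt; apply/negP => kd; apply: (@robber_evades G d k).
Qed.

(** * The affine plane as a graph of large cop number *)

Section AffinePlane.
Variable F : finFieldType.

(* [inl (x, y)] is a point, [inr (m, b)] the line of equation [y = m x + b]. *)
Definition incidence (u v : F * F + F * F) : bool :=
  match u, v with
  | inl p, inr l | inr l, inl p => p.2 == l.1 * p.1 + l.2
  | _, _ => false
  end.

Lemma incidence_sym : symmetric incidence.
Proof. by move=> [p|l] [p'|l']. Qed.

Lemma incidence_irr : irreflexive incidence.
Proof. by move=> [p|l]. Qed.

Definition affine_plane : graph := Graph incidence_sym incidence_irr.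

Lemma affine_plane_order : graph_order affine_plane = (2 * #|F| ^ 2)%N.
Proof.
by rewrite /graph_order /= card_sum !card_prod mulnn mul2n addnn.
Qed.

Lemma affine_plane_triangle_free : triangle_free affine_plane.
Proof. by move=> [x|x] [y|y] [z|z]. Qed.

(** Subtracting the four equations gives [(m - m') (x - x') = 0]. Equal slopes force equal
    intercepts; equal abscissas force [p = p']. *)
Lemma two_points_one_line (p p' l l' : F * F) : p != p' ->
  p.2 = l.1 * p.1 + l.2 -> p.2 = l'.1 * p.1 + l'.2 ->
  p'.2 = l.1 * p'.1 + l.2 -> p'.2 = l'.1 * p'.1 + l'.2 -> l = l'.
Proof.
case: p p' l l' => [x y] [x' y'] [m b] [m' b'] /= neq e1 e2 e3 e4.
have /eqP : (m - m') * (x - x') = 0.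
  have -> : (m - m') * (x - x') =
    ((m * x + b) - (m' * x + b')) - ((m * x' + b) - (m' * x' + b')) by ring.
  by rewrite -e1 -e2 -e3 -e4 !subrr.
rewrite mulf_eq0 !subr_eq0 => /orP[/eqP mm|/eqP xx].
  by move: e2; rewrite e1 mm => /addrI ->.
by move: neq; rewrite e1 e3 xx eqxx.
Qed.

Lemma affine_plane_square_free : square_free affine_plane.
Proof.
move=> [p|l] [p'|l'] [u|u] [v|v] //= neq /eqP e1 /eqP e2 /eqP e3 /eqP e4.
  by congr inr; apply: (@two_points_one_line p p').
(* Dual case: two distinct common points would make the two lines equal. *)
congr inl; apply/eqP; case: (eqVneq u v) => // uv.
by move: neq; rewrite (@two_points_one_line u v l l') // eqxx.
Qed.

Lemma affine_plane_degree : min_degree_ge affine_plane #|F|.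
Proof.
move=> [[x y]|[m b]].
  pose f (m : F) : affine_plane := inr (m, y - m * x).
  have finj : injective f by move=> ? ? [].
  rewrite -(card_codom finj); apply/subset_leq_card/fintype.subsetP => _ /codomP[m ->].
  by rewrite inE /= addrC subrK.
pose f (x : F) : affine_plane := inl (x, m * x + b).
have finj : injective f by move=> ? ? [].
rewrite -(card_codom finj); apply/subset_leq_card/fintype.subsetP => _ /codomP[x ->].
by rewrite inE /=.
Qed.

Lemma affine_plane_connected : connected_graph affine_plane.
Proof.
split.
  by rewrite affine_plane_order muln_gt0 expn_gt0 (ltnW (card_finNzRing_gt1 F)).
have edge (u v : affine_plane) : incidence u v -> connect (@adj affine_plane) u v.
  exact: connect1.
(* Everything is joined to the origin: points off the vertical axis by a line through it, lines via
   their point of abscissa 1, the remaining points via a horizontal line. *)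
pose o : affine_plane := inl (0, 0).
have nonvertical x y : x != 0 -> connect (@adj affine_plane) (inl (x, y)) o.
  move=> x0; apply: (@connect_trans _ _ (inr (y / x, 0))); apply: edge => /=.
    by rewrite addr0 divfK.
  by rewrite mulr0 addr0.
have line m b : connect (@adj affine_plane) (inr (m, b)) o.
  apply: connect_trans (nonvertical 1 (m + b) (oner_neq0 _)); apply: edge.
  by rewrite /= mulr1.
have too u : connect (@adj affine_plane) u o.
  case: u => [[x y]|[m b]]; last exact: line.
  by apply: connect_trans (line 0 y); apply: edge; rewrite /= mul0r add0r.
move=> u v; apply: connect_trans (too u) _.
by rewrite (sym_connect_sym (@adj_sym affine_plane)).
Qed.

End AffinePlane.

(** * The quadratic upper bound *)

Lemma exists_large_cop_number (k : nat) : (0 < k)%N ->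
  exists G : graph,
    [/\ connected_graph G, (k <= cop_number G)%N & (graph_order G <= 8 * k ^ 2)%N].
Proof.
move=> k0; have /andP[le_k lt_k] := @trunc_log_bounds 2 k isT k0.
have [F _ cardF] := @pPrimePowerField 2 (trunc_log 2 k).+1 isT isT.
have connF := affine_plane_connected F.
exists (affine_plane F); split => //.
  apply: (@leq_trans #|F|); first by rewrite cardF ltnW.
  apply: cop_number_ge_min_degree connF.1.
  - exact: affine_plane_triangle_free.
  - exact: affine_plane_square_free.
  - exact: affine_plane_degree.
(* With [q = 2 ^ t.+1] and [2 ^ t <= k], the order [2 q ^ 2] is [8 (2 ^ t) ^ 2]. *)
rewrite affine_plane_order cardF (expnS 2) expnMn mulnA leq_mul2l /=.
by rewrite leq_exp2r.
Qed.

Lemma min_orderP (k : nat) : (0 < k)%N -> is_min_order k (min_order k).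
Proof.
move=> k0; apply: (@xgetPex _ 0%N [set n | is_min_order k n]).
pose realized n :=
  `[< exists G : graph,
        [/\ connected_graph G, (k <= cop_number G)%N & graph_order G = n] >].
have : exists n, realized n.
  have [G [connG kG _]] := exists_large_cop_number k k0.
  by exists (graph_order G); apply/asboolP; exists G.
move=> /ex_minnP[n /asboolP nP nmin]; exists n; split => // G connG kG.
by apply: nmin; apply/asboolP; exists G.
Qed.

Lemma min_order_le (k : nat) : (0 < k)%N -> (min_order k <= 8 * k ^ 2)%N.
Proof.
move=> k0; have [G [connG kG leG]] := exists_large_cop_number k k0.
exact: leq_trans ((min_orderP k k0).2 G connG kG) leG.
Qed.

Lemma min_order_bigO (R : realType) :
  (fun k : nat => (min_order k)%:R : R) =O_\oo (fun k : nat => k%:R ^+ 2 : R).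
Proof.
apply/eqO_exP; exists 8 => //; near=> k.
have k0 : (0 < k)%N by near: k; apply: nbhs_infty_gt.
rewrite !ger0_norm ?exprn_ge0 ?ler0n // -natrX -natrM ler_nat.
exact: min_order_le.
Unshelve. all: by end_near. Qed.

(** * Equivalence with Meyniel's conjecture *)

Lemma meyniel_min_order_bigOmega (R : realType) : meyniel_conjecture R ->
  (fun k : nat => (min_order k)%:R : R) =Omega_\oo (fun k : nat => k%:R ^+ 2 : R).
Proof.
move=> [d d0 meyniel]; rewrite eqOmegaE eqOmegaO; apply/eqO_exP.
exists (d ^+ 2); first exact: exprn_gt0.
near=> k.
have k0 : (0 < k)%N by near: k; apply: nbhs_infty_gt.
have [[G [connG kG <-]] _] := min_orderP k k0.
rewrite !ger0_norm ?exprn_ge0 ?ler0n //.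
rewrite -[X in _ * X]sqr_sqrtr ?ler0n // -exprMn.
rewrite lerXn2r ?nnegrE ?ler0n ?mulr_ge0 ?sqrtr_ge0 ?(ltW d0) //.
by apply: le_trans (meyniel G connG); rewrite ler_nat.
Unshelve. all: by end_near. Qed.

Lemma min_order_bigOmega_meyniel (R : realType) :
  (fun k : nat => (min_order k)%:R : R) =Omega_\oo (fun k : nat => k%:R ^+ 2 : R) ->
  meyniel_conjecture R.
Proof.
rewrite eqOmegaE eqOmegaO => /eqO_exP[c c0 [N _ large]].
have sc0 : 0 < Num.sqrt c by rewrite sqrtr_gt0.
(* The summand [N] handles cop numbers up to [N], as the order is at least 1; beyond [N], the bound
   [k ^ 2 <= c m_k <= c n] at [k = cop_number G] yields [sqrt c]. *)
exists (N%:R + Num.sqrt c); first by rewrite ltr_wpDl ?ler0n.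
move=> G connG; rewrite mulrDl.
have sqrt1 : 1 <= Num.sqrt (graph_order G)%:R :> R.
  by rewrite -[X in X <= _]sqrtr1 ler_sqrt ?ler0n // ler1n connG.1.
have [small|] := leqP (cop_number G) N.
  apply: ler_wpDr; first by rewrite mulr_ge0 ?sqrtr_ge0.
  by apply: le_trans (ler_peMr _ sqrt1); rewrite ?ler_nat ?ler0n.
move=> NG; have k0 := leq_ltn_trans (leq0n N) NG.
have := large _ (ltnW NG); rewrite /= !ger0_norm ?exprn_ge0 ?ler0n // => le_c.
apply: ler_wpDl; first by rewrite mulr_ge0 ?sqrtr_ge0.
rewrite -sqrtrM ?(ltW c0) // -[X in X <= _]ger0_norm ?ler0n // -sqrtr_sqr.
apply: ler_wsqrtr; apply: le_trans le_c _; rewrite ler_pM2l // ler_nat.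
exact: (min_orderP _ k0).2.
Qed.

Theorem theorem3 (R : realType) :
  (forall k : nat, (0 < k)%N -> is_min_order k (min_order k)) /\
  (fun k : nat => (min_order k)%:R : R) =O_\oo (fun k : nat => k%:R ^+ 2 : R) /\
  (meyniel_conjecture R <->
    (fun k : nat => (min_order k)%:R : R) =Omega_\oo (fun k : nat => k%:R ^+ 2 : R)).
Proof.
split; first exact: min_orderP.
split; first exact: min_order_bigO.
split; [exact: meyniel_min_order_bigOmega | exact: min_order_bigOmega_meyniel].
Qed.
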